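(* Let $n\ge 2$ be an integer. For each $q\in\mathsf{Q}_{12}=\{4,8,12,20,24,36,40,60,72,120,180,360\}$, the set $$\left\{e^{i\frac{2\pi}{q}r}\,\mathbf{\Sigma}_j \;:\; j=0,1,2,3,\ r=0,1,\dots,q-1\right\}$$ of $q$-generalized phase-shifted $n$-ary full $\Sigma$-matrices is, under the $n$-ary multiplication $\mu^{[n]}[A_1,\dots,A_n]=A_1A_2\cdots A_n$ (ordinary matrix product), a finite $n$-ary group of order $4q$. The $12$ $n$-ary groups obtained for $q\in\mathsf{Q}_{12}$ are pairwise non-isomorphic.
   Context: The $\sigma$-matrices are $\sigma_0=I_2$, $\sigma_1=\begin{pmatrix}0&1\\1&0\end{pmatrix}$, $\sigma_2=\begin{pmatrix}0&-i\\i&0\end{pmatrix}$, $\sigma_3=\begin{pmatrix}1&0\\0&-1\end{pmatrix}$. Matrices of size $2(n-1)\times 2(n-1)$ are viewed as $(n-1)\times(n-1)$ block matrices with $2\times2$ complex blocks. For $j\in\{0,1,2,3\}$, the full $\Sigma$-matrix $\mathbf{\Sigma}_j$ is the block matrix having $\sigma_j$ in each of the block positions $(1,2),(2,3),\dots,(n-2,n-1)$ and $(n-1,1)$, and zero blocks elsewhere (for $n=2$, $\mathbf{\Sigma}_j=\sigma_j$). An $n$-ary group (in the sense of Dörnte) is a nonempty set $G$ with a map $\mu:G^n\to G$ that is totally associative (in an expression $\mu[a_1,\dots,a_i,\mu[a_{i+1},\dots,a_{i+n}],a_{i+n+1},\dots,a_{2n-1}]$ the value does not depend on $i\in\{0,\dots,n-1\}$)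 and such that for each position $i$ and all $a_1,\dots,a_{i-1},a_{i+1},\dots,a_n,b\in G$ the equation $\mu[a_1,\dots,a_{i-1},x,a_{i+1},\dots,a_n]=b$ has a unique solution $x\in G$; in particular each $a\in G$ has a querelement $\tilde a$, satisfying $\mu[a,\dots,a,\tilde a]=a$ with $\tilde a$ allowed in any one of the $n$ places. Isomorphisms are bijections compatible with the $n$-ary multiplications. *)

(* Defs.v *)
From mathcomp Require Import all_boot all_order all_algebra.
From mathcomp Require Import all_classical all_reals all_analysis.
From mathcomp Require Export complex.

Set Implicit Arguments.
Unset Strict Implicit.
Unset Printing Implicit Defensive.

Import Order.TTheory GRing.Theory Num.Theory.

Local Open Scope classical_set_scope.
Local Open Scope ring_scope.
Local Open Scope complex_scope.

Section NaryGroups.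
Variables (n : nat) (T : Type).
Implicit Types (G : set T) (mu : T ^ n -> T).

(* With 0-based indices, the value of
     mu[a_0, .., a_(i-1), mu[a_i, .., a_(i+n-1)], a_(i+n), .., a_(2n-2)];
   only the first 2n-1 terms of [a] are used when i < n. *)
Definition nary_nested mu (a : nat -> T) (i : nat) : T :=
  mu [ffun k : 'I_n =>
        if (k < i)%N then a k
        else if k == i :> nat then mu [ffun l : 'I_n => a (i + l)%N]
        else a (k + n.-1)%N].

Definition nary_closed G mu : Prop :=
  forall a : T ^ n, (forall k, G (a k)) -> G (mu a).

Definition totally_associative G mu : Prop :=
  forall a : nat -> T, (forall k, (k < (2 * n).-1)%N -> G (a k)) ->
  forall i j, (i < n)%N -> (j < n)%N -> nary_nested mu a i = nary_nested mu a j.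

Definition uniquely_solvable G mu : Prop :=
  forall (i : 'I_n) (a : T ^ n) (b : T),
    (forall k, k != i -> G (a k)) -> G b ->
  exists! x, G x /\ mu [ffun k => if k == i then x else a k] = b.

(* [mu] is defined on an ambient type [T]; it is its restriction to the
   subset [G] that is an n-ary group. *)
Definition nary_group G mu : Prop :=
  [/\ G !=set0, nary_closed G mu, totally_associative G mu
    & uniquely_solvable G mu].

End NaryGroups.

Definition nary_isomorphic (n : nat) (T T' : Type)
    (G : set T) (mu : T ^ n -> T) (G' : set T') (mu' : T' ^ n -> T') : Prop :=
  exists2 f : T -> T', set_bij G G' f &
    forall a : T ^ n, (forall k, G (a k)) ->
      f (mu a) = mu' [ffun k => f (a k)].

Section SigmaMatrices.
Variable R : realType.

Definition cexpi (t : R) : R[i] := cos t +i* sin t.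

Definition mx2 (a b c d : R[i]) : 'M[R[i]]_2 :=
  \matrix_(i < 2, j < 2)
    if i == 0 then (if j == 0 then a else b) else (if j == 0 then c else d).

Definition sigma (j : 'I_4) : 'M[R[i]]_2 :=
  tnth [tuple 1%:M; mx2 0 1 1 0; mx2 0 (- 'i%C) 'i%C 0; mx2 1 0 0 (- 1)] j.

(* The dimension of this block matrix is \sum_(k < n.-1) 2 = 2 * n.-1.
   Blocks are indexed from 0, so the block positions (1,2), .., (n-2,n-1) read
   (k, k+1), and (n-1,1) reads (n-2, 0). *)
Definition Sigma (n : nat) (j : 'I_4) : 'M[R[i]]_(\sum_(k < n.-1) 2) :=
  \mxblock_(k < n.-1, l < n.-1)
    (if (l == k.+1 :> nat) || ((k.+1 == n.-1) && (l == 0 :> nat))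
     then sigma j else 0).

Definition phase_shifted_Sigma (n q : nat) :
    set 'M[R[i]]_(\sum_(k < n.-1) 2) :=
  [set cexpi (2 * pi / q%:R * r%:R) *: Sigma n j
     | j in [set: 'I_4] & r in `I_q].

Definition nary_mulmx (n m : nat) (A : 'M[R[i]]_m ^ n) : 'M[R[i]]_m :=
  \prod_(k < n) A k.

End SigmaMatrices.

Arguments phase_shifted_Sigma : clear implicits.

Definition Q12 : seq nat :=
  [:: 4; 8; 12; 20; 24; 36; 40; 60; 72; 120; 180; 360]%N.

(* Main.v *)
(* Let P be the cyclic block shift of order n - 1. The full Sigma-matrices are
   P (x) sigma_j, and (P (x) M_1) ... (P (x) M_n) = P^n (x) (M_1 ... M_n)
   = P (x) (M_1 ... M_n). So M |-> P (x) M turns the n-fold product on the set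
   {e^(2 pi i r / q) sigma_j}, which is an ordinary group of order 4q because
   4 | q makes i a q-th root of unity, into the n-ary multiplication. The orders
   4q separate the isomorphism classes. *)
Require Import Defs.
From mathcomp Require Import all_boot all_order all_algebra.
From mathcomp Require Import all_classical all_reals all_analysis.
From mathcomp Require Import zify ring lra.

Set Implicit Arguments.
Unset Strict Implicit.
Unset Printing Implicit Defensive.

Import Order.TTheory GRing.Theory Num.Theory.
Local Open Scope classical_set_scope.
Local Open Scope ring_scope.
Local Open Scope complex_scope.

(** * Total associativity of iterated products *)

Definition nary_prod (A : pzSemiRingType) (n : nat) (a : A ^ n) : A :=
  \prod_(k < n) a k.

(** Unfolding the inner product leaves the 2n-1 terms in their order. The right-hand side is free of
    i, which is total associativity. *)
Lemma nary_nested_prodE (A : pzSemiRingType) n (a : nat -> A) i :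
  (i < n)%N ->
  nary_nested (@nary_prod A n) a i = \prod_(0 <= k < (2 * n).-1) a k.
Proof.
move=> ltin; rewrite /nary_nested /nary_prod.
pose F k := if (k < i)%N then a k
  else if k == i then \prod_(l < n) a (i + l)%N else a (k + n.-1)%N.
transitivity (\prod_(0 <= k < n) F k).
  rewrite big_mkord; apply: eq_bigr => k _; rewrite !ffunE /F.
  case: ifP => // _; case: ifP => // _.
  by apply: eq_bigr => l _; rewrite ffunE.
rewrite (@big_cat_nat _ _ _ i) //= 1?ltnW // [X in _ * X]big_ltn //.
rewrite [RHS](@big_cat_nat _ _ _ i) //=; last by lia.
rewrite [X in _ = _ * X](@big_cat_nat _ _ _ (i + n)) /=; [|lia|lia].
congr (_ * (_ * _)).
- by apply: eq_big_nat => k; rewrite /F => /andP[_ ->].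
- rewrite /F ltnn eqxx -{2}(add0n i) big_addn addKn big_mkord.
  by apply: eq_bigr => l _; rewrite addnC.
(* The inner product takes n terms but fills one slot, so the slots after i read [a] at a shift of n
   - 1. *)
- have -> : (i + n = i.+1 + n.-1)%N by lia.
  rewrite big_addn; have -> : ((2 * n).-1 - n.-1 = n)%N by lia.
  apply: eq_big_nat => k /andP[ltik _].
  by rewrite /F ltnNge (ltnW ltik) /= gtn_eqF.
Qed.

(** * From an ordinary group to an n-ary group *)

Section GroupImage.
Variables (A B : pzSemiRingType) (H : set A).
Hypotheses (H1 : H 1) (HM : forall x y, H x -> H y -> H (x * y))
  (HV : forall x, H x -> exists y, [/\ H y, y * x = 1 & x * y = 1]).

Lemma mem_prod n (h : 'I_n -> A) : (forall k, H (h k)) -> H (\prod_k h k).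
Proof. by move=> Hh; elim/big_ind: _. Qed.

(** L and R are the products of the factors before and after slot i; solving for one slot thus
    becomes two-sided division. *)
Lemma prod_slot n (i : 'I_n) (h : 'I_n -> A) :
  (forall k, k != i -> H (h k)) ->
  exists L R, [/\ H L, H R &
    forall x, \prod_k (if k == i then x else h k) = L * x * R].
Proof.
elim: n => [|n IH] in i h *; first by case: i.
move=> Hh; case: (unliftP ord0 i) Hh => [j|] -> Hh.
- have [|L [R [HL HR E]]] := IH j (fun k => h (lift ord0 k)).
    by move=> k nkj; apply: Hh; rewrite (inj_eq (@lift_inj _ _)).
  exists (h ord0 * L), R; split=> // [|x]; first by apply: HM => //; apply: Hh.
  rewrite big_ord_recl /= -!mulrA; congr (_ * _); rewrite mulrA -E.
  by apply: eq_bigr => k _; rewrite (inj_eq (@lift_inj _ _)).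
- exists 1, (\prod_k h (lift ord0 k)); split=> // [|x].
    by apply: mem_prod => k; apply: Hh.
  by rewrite big_ord_recl /= mul1r.
Qed.

Variables (n : nat) (f : A -> B).
Hypotheses (injf : injective f)
  (fM : forall h : 'I_n -> A, \prod_k f (h k) = f (\prod_k h k)).

(** The map [f] respects products of n factors, as M |-> P (x) M does; two factors would produce
    P^2. Each equation pulls back to L x R = b in [H], and injectivity of [f] carries uniqueness
    over. *)
Lemma nary_group_image : nary_group (f @` H) (@nary_prod B n).
Proof.
split.
- by exists (f 1); exists 1.
- move=> a Ga.
  have /choice[h Eh] : forall k, exists x, H x /\ f x = a k.
    by move=> k; case: (Ga k) => x; exists x.
  exists (\prod_k h k); first by apply: mem_prod => k; case: (Eh k).
  by rewrite -fM; apply: eq_bigr => k _; case: (Eh k).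
- by move=> a _ i j ltin ltjn; rewrite !nary_nested_prodE.
- move=> i a _ Ga [b Hb <-].
  (* The entry of [a] at slot i may lie outside the image; 1 is a filler there. *)
  have /choice[h Eh] : forall k, exists x, k != i -> H x /\ f x = a k.
    move=> k; case: (eqVneq k i) => [_|nki]; first by exists 1.
    by case: (Ga k nki) => x Hx <-; exists x.
  have [L [R [HL HR E]]] := @prod_slot n i h (fun k nki => (Eh k nki).1).
  have prodE x : nary_prod [ffun k => if k == i then f x else a k]
               = f (L * x * R).
    rewrite -E -fM; apply: eq_bigr => k _; rewrite ffunE.
    by case: eqP => // /eqP /Eh[].
  have [L' [HL' L'L LL']] := HV HL; have [R' [HR' R'R RR']] := HV HR.
  exists (f (L' * b * R')); split.
    split; first by exists (L' * b * R') => //; do !apply: HM.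
    by rewrite prodE !mulrA LL' mul1r -mulrA R'R mulr1.
  move=> _ [[x Hx <-]]; rewrite prodE => /injf <-.
  by rewrite !mulrA L'L mul1r -mulrA RR' mulr1.
Qed.

End GroupImage.

(** * Cyclic block shifts *)

Section ShiftBlock.
Variables (A : pzSemiRingType) (m p : nat).

(** This is P^s (x) M, with P the cyclic shift of the m block indices. *)
Definition shift_block (s : nat) (M : 'M[A]_p) : 'M[A]_(\sum_(k < m) p) :=
  \mxblock_(k < m, l < m) (if l == ((k + s) %% m)%N :> nat then M else 0).

(** Block row k of the left factor is supported in column k + s modulo m, so a single term of the
    block product survives. *)
Lemma shift_blockM s t (M N : 'M[A]_p) :
  shift_block s M *m shift_block t N = shift_block (s + t) (M *m N).
Proof.
rewrite /shift_block mul_mxblock; apply: eq_mxblock => k l.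
have m_gt0 : (0 < m)%N by case: (m) k => // -[].
rewrite (bigD1 (Ordinal (ltn_pmod (k + s)%N m_gt0))) //= eqxx big1 => [|j].
  by rewrite addr0 modnDml addnA; case: ifP => _; rewrite ?mulmx0.
by rewrite -val_eqE /= => /negPf->; rewrite mul0mx.
Qed.

Lemma shift_block_prod n s (h : 'I_n.+1 -> 'M[A]_p) :
  \prod_k shift_block s (h k) = shift_block (n.+1 * s) (\prod_k h k).
Proof.
elim: n => [|n IH] in h *; first by rewrite !big_ord1 mul1n.
by rewrite big_ord_recl IH [LHS]shift_blockM -mulSn [in RHS]big_ord_recl.
Qed.

Lemma shift_block_mod s M : shift_block (s %% m)%N M = shift_block s M.
Proof. by apply: eq_mxblock => k l; rewrite modnDmr. Qed.

Lemma shift_blockZ s c M : c *: shift_block s M = shift_block s (c *: M).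
Proof.
by apply/matrixP => i j; rewrite !mxE; case: ifP; rewrite !mxE ?mulr0.
Qed.

(** M can be read off in block row 0, column s modulo m. *)
Lemma shift_block_inj s : (0 < m)%N -> injective (shift_block s).
Proof.
move=> m_gt0 M N; rewrite /shift_block => /eq_mxblockP.
move=> /(_ (Ordinal m_gt0) (Ordinal (ltn_pmod s m_gt0))).
by rewrite /= add0n eqxx.
Qed.

End ShiftBlock.

(** The superdiagonal and the corner block are the cases of l = k + 1 modulo n - 1 without and with
    wrap-around. *)
Lemma SigmaE (R : realType) n j :
  Sigma R n j = shift_block n.-1 1 (sigma R j).
Proof.
apply: eq_mxblock => k l; congr (if _ then _ else _); rewrite addn1.
case: (ltngtP k.+1 n.-1) => [ltkn|ltkn|eqkn].
- by rewrite modn_small // orbF.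
- by have := ltn_ord k; lia.
- by rewrite eqkn modnn /= [_ == n.-1 :> nat]ltn_eqF.
Qed.

(** * Complex phases and roots of unity *)

Section PhasedSigma.
Variable R : realType.

Lemma cexpiD (s t : R) : cexpi (s + t) = cexpi s * cexpi t.
Proof.
rewrite /cexpi cosD sinD; apply/eqP; rewrite eq_complex /=.
by rewrite [cos s * sin t + _]addrC !eqxx.
Qed.

Lemma cexpi0 : cexpi (0 : R) = 1.
Proof. by rewrite /cexpi cos0 sin0. Qed.

Lemma cexpi2pi : cexpi (2 * pi : R) = 1.
Proof. by rewrite mulr_natl /cexpi cos2pi sin2pi. Qed.

Lemma cexpi_neq0 (t : R) : cexpi t != 0.
Proof.
apply/eqP => t0; have /eqP := cexpiD t (- t).
by rewrite subrr cexpi0 t0 mul0r oner_eq0.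
Qed.

(** The real part suffices: cos t = 1 - 2 sin^2(t/2), and sin(t/2) > 0 when 0 < t < 2 pi. *)
Lemma cexpi_eq1 (t : R) : 0 <= t < 2 * pi -> cexpi t = 1 -> t = 0.
Proof.
case/andP=> t_ge0 t_lt [+ _]; apply: contra_eq => t_neq0.
have -> : t = (t / 2) *+ 2 by rewrite -mulr_natr divfK ?pnatr_eq0.
have sin_gt0 : 0 < sin (t / 2).
  by apply: sin_gt0_pi; rewrite divr_gt0 ?lt_def ?t_neq0 //=; lra.
rewrite cos_mulr2n cos2sin2; apply/eqP => E.
by have := exprn_gt0 2 sin_gt0; lra.
Qed.

Definition phase (q r : nat) : R[i] := cexpi (2 * pi / q%:R * r%:R).

Lemma phase0 q : phase q 0 = 1.
Proof. by rewrite /phase mulr0 cexpi0. Qed.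

Lemma phaseD q r s : phase q (r + s) = phase q r * phase q s.
Proof. by rewrite /phase natrD mulrDr cexpiD. Qed.

Lemma phase_period q : (0 < q)%N -> phase q q = 1.
Proof. by move=> q_gt0; rewrite /phase divfK ?cexpi2pi ?pnatr_eq0 -?lt0n. Qed.

Lemma phase_mod q r : (0 < q)%N -> phase q (r %% q)%N = phase q r.
Proof.
move=> q_gt0; rewrite [in RHS](divn_eq r q) phaseD.
suff -> : phase q (r %/ q * q)%N = 1 by rewrite mul1r.
elim: (r %/ q)%N => [|k IH]; first by rewrite phase0.
by rewrite mulSn phaseD IH phase_period ?mulr1.
Qed.

(** If r < s, the quotient of the phases is 1 although its angle lies strictly between 0 and 2
    pi. *)
Lemma phase_inj q r s : (r < q)%N -> (s < q)%N ->
  phase q r = phase q s -> r = s.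
Proof.
wlog ltrs : r s / (r < s)%N => [W|] ltrq ltsq E.
  by case: (ltngtP r s) => // ?; [apply: W | apply/esym/W].
have q_gt0 : 0 < q%:R :> R by rewrite ltr0n; lia.
have pi2 : 0 < 2 * pi :> R by rewrite mulr_gt0 ?pi_gt0.
have rs_gt0 : 0 < (s - r)%:R :> R by rewrite ltr0n subn_gt0.
suff : 2 * pi / q%:R * (s - r)%:R = 0 :> R.
  by move/eqP; rewrite gt_eqF // mulr_gt0 ?divr_gt0.
apply: cexpi_eq1.
  apply/andP; split; first by apply/ltW; rewrite mulr_gt0 ?divr_gt0.
  rewrite mulrAC ltr_pdivrMr // ltr_pM2l // ltr_nat.
  exact: leq_ltn_trans (leq_subr r s) ltsq.
apply: (mulfI (cexpi_neq0 (2 * pi / q%:R * r%:R))).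
by rewrite -[LHS]phaseD subnKC ?(ltnW ltrs) // mulr1 -[LHS]E.
Qed.

(** Divisibility by 4 makes i a q-th root of unity, which lets phases absorb the factors i of sigma
    products. *)
Lemma phase_quarter q : (0 < q)%N -> (4 %| q)%N -> phase q (q %/ 4) = 'i%C.
Proof.
move=> q_gt0 /dvdnP[k def_q]; rewrite def_q mulnK // /phase natrM.
have k_neq0 : k%:R != 0 :> R by rewrite pnatr_eq0; lia.
have -> : 2 * pi / (k%:R * 4) * k%:R = pi / 2 :> R by field.
by rewrite /cexpi cos_pihalf sin_pihalf.
Qed.

(** * Algebra of the sigma-matrices *)

Lemma mul_mx2 (a b c d a' b' c' d' : R[i]) :
  mx2 a b c d *m mx2 a' b' c' d' =
  mx2 (a * a' + b * c') (a * b' + b * d') (c * a' + d * c') (c * b' + d * d').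
Proof.
apply/matrixP => i j; rewrite !mxE !big_ord_recl big_ord0 !mxE /= addr0.
by case: (unliftP 0 i) => [k|] ->; case: (unliftP 0 j) => [l|] ->.
Qed.

Lemma scale_mx2 (x a b c d : R[i]) :
  x *: mx2 a b c d = mx2 (x * a) (x * b) (x * c) (x * d).
Proof. by apply/matrixP => i j; rewrite !mxE; do 2!case: eqP. Qed.

Lemma mx2_1 : 1%:M = mx2 1 0 0 (1 : R[i]).
Proof.
apply/matrixP => i j; rewrite !mxE.
by case: i j => [[|[]]//= ?] [[|[]]//= ?].
Qed.

Lemma mxtrace_mx2 (a b c d : R[i]) : \tr (mx2 a b c d) = a + d.
Proof. by rewrite /mxtrace !big_ord_recl big_ord0 !mxE addr0. Qed.

Lemma sigmaM (j k : 'I_4) :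
  exists l s, sigma R j *m sigma R k = 'i%C ^+ s *: sigma R l.
Proof.
(* The index of the product is the bitwise xor of [j] and [k]. *)
pose index : seq (seq nat) :=
  [:: [:: 0; 1; 2; 3]; [:: 1; 0; 3; 2]; [:: 2; 3; 0; 1]; [:: 3; 2; 1; 0]]%N.
(* Exponents of i: 1 for the cyclic products such as sigma_1 sigma_2 = i sigma_3, 3 for the reversed
   ones, 0 otherwise. *)
pose power : seq (seq nat) :=
  [:: [:: 0; 0; 0; 0]; [:: 0; 0; 1; 3]; [:: 0; 3; 0; 1]; [:: 0; 1; 3; 0]]%N.
exists (inord (nth 0 (nth [::] index j) k))%N, (nth 0 (nth [::] power j) k)%N.
case: j k => [[|[|[|[|//]]]] ?] [[|[|[|[|//]]]] ?].
all: rewrite /sigma !(tnth_nth 0) inordK //= ?mx2_1 mul_mx2 scale_mx2.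
all: rewrite ?exprS expr0; congr mx2; apply/eqP; rewrite eq_complex /=.
all: by apply/andP; split; apply/eqP; ring.
Qed.

Lemma sigma_sqr (j : 'I_4) : sigma R j *m sigma R j = 1%:M.
Proof.
case: j => [[|[|[|[|//]]]] ?]; rewrite /sigma !(tnth_nth 0) /= mx2_1 mul_mx2.
all: congr mx2; apply/eqP; rewrite eq_complex /=.
all: by apply/andP; split; apply/eqP; ring.
Qed.

Lemma sigma_orthogonal (j k : 'I_4) : j != k ->
  \tr (sigma R j *m sigma R k) = 0.
Proof.
case: j k => [[|[|[|[|//]]]] ?] [[|[|[|[|//]]]] ?] // _.
all: rewrite /sigma !(tnth_nth 0) /= ?mx2_1 mul_mx2 mxtrace_mx2.
all: by ring.
Qed.

(** Pairing with sigma_k under the trace gives 2c = 2d if j = k, and 0 = 2d otherwise. *)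
Lemma scale_sigma_inj (c d : R[i]) (j k : 'I_4) : d != 0 ->
  c *: sigma R j = d *: sigma R k -> c = d /\ j = k.
Proof.
move=> d_neq0 /(congr1 (fun M => \tr (M *m sigma R k))).
rewrite -!scalemxAl !mxtraceZ sigma_sqr mxtrace1.
case: (eqVneq j k) => [->|/sigma_orthogonal->].
  by rewrite sigma_sqr mxtrace1 => /mulIf-> //; rewrite pnatr_eq0.
by move=> /esym/eqP; rewrite mulr0 mulf_eq0 (negPf d_neq0) pnatr_eq0.
Qed.

(** * The ordinary group of phased 2 x 2 sigma-matrices *)

Definition phased_sigma (q : nat) : set 'M[R[i]]_2 :=
  [set phase q r *: sigma R j | j in [set: 'I_4] & r in `I_q].

(** Since r may exceed q - 1, products and inverses need no reduction of exponents. *)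
Lemma mem_phased_sigma q r j : (0 < q)%N ->
  phased_sigma q (phase q r *: sigma R j).
Proof.
move=> q_gt0; exists j => //; exists (r %% q)%N; first exact: ltn_pmod.
by rewrite phase_mod.
Qed.

Lemma phased_sigma1 q : (0 < q)%N -> phased_sigma q 1.
Proof.
by move=> q_gt0; have := mem_phased_sigma 0 ord0 q_gt0; rewrite phase0 scale1r.
Qed.

Lemma phased_sigmaM q : (0 < q)%N -> (4 %| q)%N ->
  forall x y, phased_sigma q x -> phased_sigma q y -> phased_sigma q (x * y).
Proof.
move=> q_gt0 dv4q _ _ [j _ [r _ <-]] [k _ [s _ <-]].
have [l [t E]] := sigmaM j k.
(* The factor i^t from the sigma product is the phase with exponent t q/4. *)
have -> : (phase q r *: sigma R j) * (phase q s *: sigma R k) =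
    phase q (r + s + q %/ 4 * t) *: sigma R l.
  rewrite -scalerAl -scalerAr [sigma R j * _]E !scalerA !phaseD.
  congr (_ * _ *: _); elim: t {E} => [|t IH]; first by rewrite muln0 phase0.
  by rewrite mulnS phaseD -IH exprS phase_quarter.
exact: mem_phased_sigma.
Qed.

Lemma phased_sigmaV q : (0 < q)%N -> forall x, phased_sigma q x ->
  exists y, [/\ phased_sigma q y, y * x = 1 & x * y = 1].
Proof.
move=> q_gt0 _ [j _ [r ltrq <-]].
(* Each sigma_j is its own inverse, and the exponent q - r stands for -r. *)
exists (phase q (q - r) *: sigma R j).
split; first exact: mem_phased_sigma.
- rewrite -scalerAl -scalerAr [sigma R j * _]sigma_sqr scalerA -phaseD.
  by rewrite subnK ?(ltnW ltrq) // phase_period // scale1r.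
- rewrite -scalerAl -scalerAr [sigma R j * _]sigma_sqr scalerA -phaseD.
  by rewrite subnKC ?(ltnW ltrq) // phase_period // scale1r.
Qed.

(** The pair (r, j) is coded as m = 4r + j; trace pairing and injectivity of phases show that no
    element is repeated. *)
Lemma card_phased_sigma q : (phased_sigma q #= `I_(4 * q))%card.
Proof.
pose g m := phase q (m %/ 4) *: sigma R (inord (m %% 4)).
have -> : phased_sigma q = g @` `I_(4 * q).
  apply/seteqP; split=> [_ [j _ [r ltrq <-]] | _ [m ltm <-]].
    exists (r * 4 + j)%N; first by have := ltn_ord j; rewrite /= in ltrq *; lia.
    by rewrite /g divnMDl // divn_small // addn0 modnMDl modn_small // inord_val.
  exists (inord (m %% 4)) => //; exists (m %/ 4)%N => //.
  by rewrite /= ltn_divLR // mulnC.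
apply: inj_card_eq => x y /set_mem ltx /set_mem lty.
move=> /(scale_sigma_inj (cexpi_neq0 _))[/phase_inj Ediv /(congr1 val) Emod].
rewrite /= !inordK ?ltn_pmod // in Emod.
rewrite (divn_eq x 4) (divn_eq y 4) Emod Ediv // ltn_divLR // mulnC //.
Qed.

Lemma phase_shifted_SigmaE n q :
  phase_shifted_Sigma R n q = shift_block n.-1 1 @` phased_sigma q.
Proof.
apply/seteqP; split=> [_ [j _ [r ltrq <-]] | _ [_ [j _ [r ltrq <-]] <-]].
  exists (phase q r *: sigma R j); first by exists j => //; exists r.
  by rewrite -shift_blockZ SigmaE.
by exists j => //; exists r => //; rewrite -shift_blockZ SigmaE.
Qed.

End PhasedSigma.

Theorem proposition6p10 (R : realType) (n : nat) (hn : (2 <= n)%N) :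
  (forall q : nat, q \in Q12 ->
     nary_group (phase_shifted_Sigma R n q) (@nary_mulmx R n _) /\
     (phase_shifted_Sigma R n q #= `I_(4 * q))%card) /\
  (forall q q' : nat, q \in Q12 -> q' \in Q12 -> q <> q' ->
     ~ nary_isomorphic (phase_shifted_Sigma R n q) (@nary_mulmx R n _)
                       (phase_shifted_Sigma R n q') (@nary_mulmx R n _)).
Proof.
have n1_gt0 : (0 < n.-1)%N by lia.
have inj1 := @shift_block_inj R[i] n.-1 2 1 n1_gt0.
have cardG q : (phase_shifted_Sigma R n q #= `I_(4 * q))%card.
  rewrite phase_shifted_SigmaE.
  apply: card_eq_trans (card_phased_sigma R q).
  by apply: inj_card_eq => x y _ _ /inj1.
split=> [q q12 | q q' _ _ neqq [f bijf _]].
  split=> //; have /andP[q_gt0 dv4q] : (0 < q)%N && (4 %| q)%N.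
    by move: q q12; apply/allP.
  rewrite phase_shifted_SigmaE; apply: nary_group_image => //.
  - exact: phased_sigma1.
  - exact: phased_sigmaM.
  - exact: phased_sigmaV.
  - case: n hn n1_gt0 {inj1 cardG} => // m _ m_gt0 h.
    (* Here n = m + 1, so the total shift m + 1 is congruent to 1 modulo m. Both sides are reduced
       because for m = 1 the shift 1 itself becomes 0. *)
    rewrite shift_block_prod muln1 -[LHS]shift_block_mod -[RHS]shift_block_mod.
    by congr (shift_block _ _ _); rewrite /= -{1}(addn1 m) modnDl.
(* The bijection underlying an isomorphism already forces 4q = 4q'. *)
apply: neqq; suff /card_eq_II : (`I_(4 * q) #= `I_(4 * q'))%card by lia.
have := cardG q; rewrite card_eq_sym => /card_eq_trans; apply.
apply: card_eq_trans (cardG q').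
by have [g _] := Pbij bijf; apply: pcard_eq g.
Qed.
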